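(* Let $X$ be an infinite discrete space, and let $G$ be a subgroup of the permutation group $({\rm S}(X),\tau_p)$ whose action on $X$ is ultratransitive. Put $\imath_X^{\Gamma}:G\to(2^{X\times X},\tau_F)$, $\imath_X^{\Gamma}(g)=\{(x,gx)\mid x\in X\}$. Then the closure $b_XG$ of $\imath_X^{\Gamma}(G)$ in $(2^{X\times X},\tau_F)$ is (algebraically) the symmetric inverse semigroup $I_X$, and it is a sim-compactification of $G$.
   Context: $\tau_p$ is the topology of pointwise convergence (permutation topology), with subbase $\{g\mid g(x)=y\}$, $x,y\in X$. The action of $G$ on $X$ is ultratransitive if for every $n$ and all pairwise distinct $x_1,\dots,x_n$ and pairwise distinct $y_1,\dots,y_n$ in $X$ there is $g\in G$ with $g(x_i)=y_i$, $i=1,\dots,n$. $2^{X\times X}$ is the set of all subsets of $X\times X$ (all are closed) with the Fell topology $\tau_F$, whose subbase is all sets $\{F\mid F\cap W\ne\emptyset\}$ ($W\subset X\times X$) and $\{F\mid F\cap K=\emptyset\}$ ($K\subset X\times X$ finite). It is a monoid under composition of relations $RS=\{(x,y)\mid\exists z\,((x,z)\in S\ \&\ (z,y)\in R)\}$ with involution $R\mapsto\{(y,x)\mid(x,y)\in R\}$. $I_X$ is the symmetric inverse semigroup: all bijections between subsets of $X$ (partial bijections, identified with their graphs, including $\emptyset$) under composition of partial maps. A compactification of $G$ is a compact Hausdorff space with a dense topological embedding of $G$; it is a $G$-compactification if the action of $G$ on itself by left multiplication extends continuously to it. An sm-compactification of $G$ is a $G$-compactification $bG$ with a monoid multiplication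 extending that of $G$ which is separately continuous. A sim-compactification is an sm-compactification which is a semitopological inverse monoid with continuous inversion extending the inversion of $G$. *)

(* Defs.v *)
From HB Require Import structures.
From mathcomp Require Import all_boot finmap.
From mathcomp Require Import all_classical topology.

Set Implicit Arguments.
Unset Strict Implicit.
Unset Printing Implicit Defensive.

Local Open Scope classical_set_scope.
Local Open Scope group_scope.

HB.mixin Record isTopologicalGroup T of Group T & Topological T := {
  mulg_continuous : continuous (fun p : T * T => p.1 * p.2);
  invg_continuous : continuous (fun x : T => x^-1)
}.

#[short(type="topologicalGroupType")]
HB.structure Definition TopologicalGroup :=
  {T of isTopologicalGroup T & Group T & Topological T}.

Definition subgroup (S : groupType) (G : groupClosed S) := {g : S | g \in G}.

HB.instance Definition _ (S : groupType) (G : groupClosed S) :=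
  SubChoice.copy (subgroup G) {g : S | g \in G}.

Lemma groupClosedP (S : groupType) (G : groupClosed S) : group_closed G.
Proof.
split; first exact: gpred1.
by move=> x y Gx Gy; apply: gpredM => //; apply: gpredVr.
Qed.

HB.instance Definition _ (S : groupType) (G : groupClosed S) :=
  SubChoice_isSubGroup.Build S (mem G) (subgroup G) (groupClosedP G).

HB.instance Definition _ (S : topologicalGroupType) (G : groupClosed S) :=
  Topological.copy (subgroup G) (initial_topology (val : subgroup G -> S)).

Section SubgroupTopology.
Variables (S : topologicalGroupType) (G : groupClosed S).

Lemma subgroup_val_continuous : continuous (val : subgroup G -> S).
Proof. exact: initial_continuous. Qed.

Lemma subgroup_continuous (T : topologicalType) (f : T -> subgroup G) :
  continuous (val \o f : T -> S) -> continuous f.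
Proof.
move=> /continuousP cf; apply/continuousP => _ [U oU <-].
exact: (cf _ oU).
Qed.

Lemma subgroup_mulg_continuous :
  continuous (fun p : subgroup G * subgroup G => p.1 * p.2).
Proof.
apply: subgroup_continuous => p.
apply: (@continuous_comp _ _ _
  (fun p : subgroup G * subgroup G => (val p.1, val p.2))
  (fun q : S * S => q.1 * q.2)); last exact: mulg_continuous.
by apply: cvg_pair; apply: continuous_comp;
  do ?[exact: cvg_fst | exact: cvg_snd | exact: subgroup_val_continuous].
Qed.

Lemma subgroup_invg_continuous : continuous (fun x : subgroup G => x^-1).
Proof.
apply: subgroup_continuous => p.
apply: (@continuous_comp _ _ _ (val : subgroup G -> S) (fun x : S => x^-1)).
  exact: subgroup_val_continuous.
exact: invg_continuous.
Qed.

HB.instance Definition _ := isTopologicalGroup.Build (subgroup G)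
  subgroup_mulg_continuous subgroup_invg_continuous.

End SubgroupTopology.

Definition symgroup (X : choiceType) := {f : X -> X | `[< bijective f >]}.

HB.instance Definition _ (X : choiceType) :=
  SubChoice.copy (symgroup X) {f : X -> X | `[< bijective f >]}.

Definition symgroup_fun (X : choiceType) (f : symgroup X) : X -> X := val f.
Coercion symgroup_fun : symgroup >-> Funclass.

Section SymGroup.
Variable X : choiceType.
Implicit Types f g h : symgroup X.

Lemma symP f g : f =1 g -> f = g.
Proof. by move=> fg; apply/val_inj/funext. Qed.

Lemma sym_bij f : bijective f.
Proof. exact/asboolP/(valP f). Qed.

Lemma sym_one_subproof : `[< bijective (@id X) >].
Proof. by apply/asboolP; exists id. Qed.

Lemma sym_mul_subproof f g : `[< bijective (f \o g) >].
Proof. by apply/asboolP/bij_comp; exact: sym_bij. Qed.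

Lemma sym_inv_subproof f :
  exists g : X -> X, [/\ cancel f g, cancel g f & `[< bijective g >]].
Proof.
by case: (sym_bij f) => g fK gK; exists g; split=> //; apply/asboolP; exists f.
Qed.

Definition sym_one : symgroup X := exist _ id sym_one_subproof.
Definition sym_mul f g : symgroup X := exist _ (f \o g) (sym_mul_subproof f g).
Definition sym_inv f : symgroup X :=
  let e := cid (sym_inv_subproof f) in
  exist _ (sval e) (let: And3 _ _ bijg := svalP e in bijg).

Lemma sym_mulA : associative sym_mul.
Proof. by move=> f g h; apply: symP. Qed.
Lemma sym_mul1 : left_id sym_one sym_mul.
Proof. by move=> f; apply: symP. Qed.
Lemma sym_mulr1 : right_id sym_one sym_mul.
Proof. by move=> f; apply: symP. Qed.
Lemma sym_mulV : left_inverse sym_one sym_inv sym_mul.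
Proof.
move=> f; apply: symP => x; rewrite /symgroup_fun /= /symgroup_fun /=.
by case: (cid _) => g [fK gK bg]; exact: fK.
Qed.
Lemma sym_mulrV : right_inverse sym_one sym_inv sym_mul.
Proof.
move=> f; apply: symP => x; rewrite /symgroup_fun /= /symgroup_fun /=.
by case: (cid _) => g [fK gK bg]; exact: gK.
Qed.

HB.instance Definition _ := isGroup.Build (symgroup X)
  sym_mulA sym_mul1 sym_mulr1 sym_mulV sym_mulrV.

HB.instance Definition _ := isSubBaseTopological.Build (symgroup X)
  [set [set g : symgroup X | g xy.1 = xy.2] | xy in [set: X * X]] id.

Lemma near_sym f x : nbhs f [set g : symgroup X | g x = f x].
Proof.
rewrite nbhsE; exists [set g : symgroup X | g x = f x] => //; split=> //.
exists [set [set g : symgroup X | g x = f x]]; last by rewrite bigcup_set1.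
move=> _ ->; exists [fset [set g : symgroup X | g x = f x]]%fset.
  by move=> A /fset1P ->; rewrite inE; exists (x, f x).
by rewrite set_fset1 bigcap_set1.
Qed.

Lemma sym_continuous (T : topologicalType) (F : T -> symgroup X) :
  (forall t x, nbhs t [set s | F s x = F t x]) -> continuous F.
Proof.
move=> nF; apply/continuousP => _ [D' sD <-]; rewrite openE => t [B D'B FB].
apply: (@filterS _ _ _ (F @^-1` B)); first by move=> s FBs; exists B.
have [A sA AB] := sD _ D'B; rewrite -AB preimage_bigcap.
apply: filter_bigI => C CA; have := sA _ CA; rewrite inE => -[[x y] _ /= CE].
have : C (F t) by move: FB; rewrite -AB; apply.
rewrite -CE /= => <-; exact: nF.
Qed.

Lemma sym_mulg_continuous :
  continuous (fun p : symgroup X * symgroup X => p.1 * p.2).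
Proof.
apply: sym_continuous => -[f0 g0] x; pose f : symgroup X := f0.
pose g : symgroup X := g0.
exists ([set f' : symgroup X | f' (g x) = f (g x)],
        [set g' : symgroup X | g' x = g x]).
  by split; exact: near_sym.
move=> [f' g'] [/= f'x g'x].
by rewrite -[LHS]/(symgroup_fun f' (symgroup_fun g' x)) g'x.
Qed.

Lemma sym_mulVK f : cancel f (f^-1 : symgroup X)%g.
Proof. by move=> x; rewrite -[LHS]/((f^-1 * f : symgroup X) x) mulVg. Qed.

Lemma sym_mulKV f : cancel (f^-1 : symgroup X)%g f.
Proof. by move=> x; rewrite -[LHS]/((f * f^-1 : symgroup X) x) mulgV. Qed.

Lemma sym_invg_continuous : continuous (fun f : symgroup X => f^-1).
Proof.
apply: sym_continuous => f x; apply: filterS (near_sym f ((f^-1 : symgroup X) x)) => g /= gx.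
by rewrite -[in LHS](sym_mulKV f x) -gx; exact: sym_mulVK.
Qed.

HB.instance Definition _ := isTopologicalGroup.Build (symgroup X)
  sym_mulg_continuous sym_invg_continuous.

End SymGroup.

Definition ultratransitive (X : choiceType) (G : groupClosed (symgroup X)) :=
  forall (n : nat) (x y : 'I_n -> X), injective x -> injective y ->
  exists2 g : symgroup X, g \in G & forall i, g (x i) = y i.

Definition fell (X : choiceType) := set (X * X).

HB.instance Definition _ (X : choiceType) :=
  Choice.copy (fell X) (set (X * X)).

Section Fell.
Variable X : choiceType.
Implicit Types R S : fell X.

(* As the space is discrete, the subsets [W] are exactly the open sets and the
   finite sets [K] exactly the compact ones. *)
Definition fell_subbase : set (set (fell X)) :=
  [set [set F : fell X | F `&` W !=set0] | W in [set: set (X * X)]] `|`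
  [set [set F : fell X | F `&` K = set0] | K in @finite_set (X * X)].

HB.instance Definition _ :=
  isSubBaseTopological.Build (fell X) fell_subbase id.

(* The right factor acts first. *)
Definition rel_mul R S : fell X :=
  [set xy | exists z, S (xy.1, z) /\ R (z, xy.2)].
Definition rel_one : fell X := [set xy | xy.1 = xy.2].
Definition rel_inv R : fell X := [set xy | R (xy.2, xy.1)].

Lemma rel_mulA : associative rel_mul.
Proof.
move=> R S T; apply/seteqP; split=> -[x y] /=.
  by move=> [z [[w [Txw Swz]] Rzy]]; exists w; split=> //; exists z.
by move=> [w [Txw [z [Swz Rzy]]]]; exists z; split=> //; exists w.
Qed.
Lemma rel_mul1 : left_id rel_one rel_mul.
Proof.
move=> R; apply/seteqP; split=> -[x y] /=; last by exists y.
by rewrite /rel_one => -[z [Rxz /= <-]].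
Qed.
Lemma rel_invK : involutive rel_inv.
Proof. by move=> R; apply/seteqP; split=> -[x y]. Qed.
Lemma rel_invM : {morph rel_inv : R S / rel_mul R S >-> rel_mul S R}.
Proof.
by move=> R S; apply/seteqP; split=> -[x y] /= [z [? ?]]; exists z.
Qed.

HB.instance Definition _ := isStarMonoid.Build (fell X)
  rel_mulA rel_mul1 rel_invK rel_invM.

End Fell.

(* A bijection between two subsets of [X] is a partial map [X -> option X] that
   is injective on its domain. *)
Definition partial_bij (X : choiceType) :=
  {f : X -> option X |
    `[< forall x1 x2 y, f x1 = Some y -> f x2 = Some y -> x1 = x2 >]}.

HB.instance Definition _ (X : choiceType) := SubChoice.copy (partial_bij X)
  {f : X -> option X |
    `[< forall x1 x2 y, f x1 = Some y -> f x2 = Some y -> x1 = x2 >]}.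

Section PartialBij.
Variable X : choiceType.
Implicit Types f g : partial_bij X.

Lemma pbij_one_subproof :
  `[< forall x1 x2 y : X, Some x1 = Some y -> Some x2 = Some y -> x1 = x2 >].
Proof. by apply/asboolP => x1 x2 y [->] [->]. Qed.

Lemma pbij_mul_subproof f g :
  `[< forall x1 x2 y, pcomp (val f) (val g) x1 = Some y ->
        pcomp (val f) (val g) x2 = Some y -> x1 = x2 >].
Proof.
have /asboolP fi := valP f; have /asboolP gi := valP g.
apply/asboolP => x1 x2 y; rewrite /pcomp.
case g1: (val g x1) => [z1|//] /= fz1; case g2: (val g x2) => [z2|//] /= fz2.
by rewrite (fi _ _ _ fz1 fz2) in g1; exact: gi g1 g2.
Qed.

Definition pbij_one : partial_bij X := exist _ some pbij_one_subproof.
Definition pbij_mul f g : partial_bij X :=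
  exist _ (pcomp (val f) (val g)) (pbij_mul_subproof f g).

Lemma pbij_mulA : associative pbij_mul.
Proof.
by move=> f g h; apply/val_inj/funext => x; rewrite /= /pcomp; case: (val h x).
Qed.
Lemma pbij_mul1 : left_id pbij_one pbij_mul.
Proof.
by move=> f; apply/val_inj/funext => x; rewrite /= /pcomp; case: (val f x).
Qed.
Lemma pbij_mulr1 : right_id pbij_one pbij_mul.
Proof. by move=> f; exact/val_inj/funext. Qed.

HB.instance Definition _ := isMonoid.Build (partial_bij X)
  pbij_mulA pbij_mul1 pbij_mulr1.

Definition pgraph f : fell X := [set xy | val f xy.1 = Some xy.2].

End PartialBij.

Definition topological_embedding (S T : topologicalType) (f : S -> T) :=
  [/\ injective f, continuous f &
      forall U, open U -> exists2 V, open V & f @` U = V `&` range f].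

Definition compactification (S T : topologicalType) (b : S -> T) :=
  [/\ compact [set: T], hausdorff_space T, topological_embedding b &
      dense (range b)].

Section GroupCompactifications.
Variables (G : topologicalGroupType) (B : topologicalType) (b : G -> B).

Definition G_compactification :=
  compactification b /\
  exists act : G -> B -> B,
    [/\ forall x, act 1 x = x,
        forall g h x, act (g * h) x = act g (act h x),
        continuous (fun p : G * B => act p.1 p.2) &
        forall g h, act g (b h) = b (g * h)].

Definition sm_compactification (mul : B -> B -> B) :=
  [/\ G_compactification,
      associative mul /\ left_id (b 1) mul /\ right_id (b 1) mul,
      {morph b : g h / g * h >-> mul g h} &
      forall x, continuous (mul x) /\ continuous (mul^~ x)].

Definition sim_compactification (mul : B -> B -> B) (inv : B -> B) :=
  [/\ sm_compactification mul,
      forall x y, mul (mul x y) x = x /\ mul (mul y x) y = y <-> y = inv x,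
      continuous inv &
      {morph b : g / g^-1 >-> inv g}].

End GroupCompactifications.

Section GraphClosure.
Variables (X : choiceType) (G : groupClosed (symgroup X)).

Definition graph_map (g : subgroup G) : fell X :=
  [set (x, (val g : symgroup X) x) | x in setT].

Definition graph_closure : set (fell X) := closure (range graph_map).

Lemma graph_closureP g : graph_map g \in graph_closure.
Proof. by apply/mem_set/subset_closure; exists g. Qed.

Definition graph_emb (g : subgroup G) : set_type graph_closure :=
  exist _ (graph_map g) (graph_closureP g).

End GraphClosure.

(* Main.v *)
(** As [X] is discrete, the Fell topology on [2^(X x X)] is the product topology
    of pointwise convergence of indicator functions, so it is compact Hausdorff.
    Being the graph of a partial bijection only involves two points at a time,
    hence is a closed condition.  Conversely, given a partial bijection [f] and
    finitely many pairs, extend [f] injectively to the first coordinates outside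
    its domain by fresh values (available as [X] is infinite) avoiding all the
    second coordinates; by ultratransitivity some [g] in [G] agrees with this
    extension, and its graph agrees with that of [f] on the given pairs. *)

Require Import Defs.
From HB Require Import structures.
From mathcomp Require Import all_boot finmap.
From mathcomp Require Import all_classical topology.

Set Implicit Arguments.
Unset Strict Implicit.
Unset Printing Implicit Defensive.

Local Open Scope classical_set_scope.
Local Open Scope group_scope.

(** * Convergence in a subspace *)

Section SubspaceTopology.
Variables (T : topologicalType) (B : set T).

Lemma cvg_set_type (F : set_system (set_type B)) (R : set_type B) :
  Filter F -> val @ F --> (val R : T) -> F --> R.
Proof.
move=> FF cF A [_ [[U oU <-] UR UA]].
by apply: filterS UA (cF U _); apply: open_nbhs_nbhs.
Qed.

Lemma set_val_continuous : continuous (val : set_type B -> T).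
Proof. exact: initial_continuous. Qed.

End SubspaceTopology.

(** * The Fell topology as pointwise convergence of membership; compactness *)

Section FellTopology.
Variable X : choiceType.
Implicit Types (R S : fell X) (p : X * X).

Lemma fell_subbase_open (A : set (fell X)) : fell_subbase A -> open A.
Proof.
move=> sA; exists [set A]; last by rewrite bigcup_set1.
move=> _ ->; exists [fset A]%fset; last by rewrite set_fset1 bigcap_set1.
by move=> B /fset1P ->; rewrite inE.
Qed.

(** Taking [W] or [K] to be the singleton of [p] makes membership of [p] a clopen condition. *)
Lemma near_fell R p : nbhs R [set S : fell X | S p <-> R p].
Proof.
have [Rp|nRp] := pselect (R p).
  apply: (@filterS _ _ _ [set S : fell X | S `&` [set p] !=set0]).
    by move=> S [q [Sq qp]]; rewrite -qp in Rp *.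
  apply: open_nbhs_nbhs; split; last by exists p.
  by apply: fell_subbase_open; left; exists [set p].
apply: (@filterS _ _ _ [set S : fell X | S `&` [set p] = set0]).
  by move=> S /= S0; split=> // Sp; suff: set0 p by []; rewrite -S0.
apply: open_nbhs_nbhs; split; last first.
  by rewrite /= -subset0 => q [Rq qp]; apply: nRp; rewrite -qp.
by apply: fell_subbase_open; right; exists [set p].
Qed.

(** Converse of [near_fell]: a set meeting [W] is witnessed by one pair, and missing a finite [K] is
    a finite conjunction of one-pair conditions. *)
Lemma cvg_fell (F : set_system (fell X)) R : Filter F ->
  (forall p, F [set S : fell X | S p <-> R p]) -> F --> R.
Proof.
move=> FF nF U [_ [[D' sD <-] [B D'B RB] BU]].
suff FB : F B by apply: filterS FB => S BS; apply: BU; exists B.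
have [A sA AB] := sD _ D'B; rewrite -AB.
apply: filter_bigI => C CA; have CR : C R by move: RB; rewrite -AB; apply.
have := sA _ CA; rewrite inE => -[[W _ /= CE]|[K finK /= CE]];
  move: CR; rewrite -{}CE.
  move=> [p [Rp Wp]]; apply: filterS (nF p) => S Sp.
  by exists p; split=> //; apply/Sp.
have /finite_fsetP [K' ->] := finK; move=> /= RK0.
apply: filterS (filter_bigI FF (fun p (_ : p \in K') => nF p)) => S SK.
rewrite /= -subset0 => p [Sp Kp]; rewrite -RK0; split=> //.
by apply/(SK p Kp).
Qed.

Lemma fell_nbhs_finite R (U : set (fell X)) : nbhs R U ->
  exists s : seq (X * X),
    forall S, (forall p, p \in s -> S p <-> R p) -> U S.
Proof.
pose agree (s : seq (X * X)) :=
  [set S : fell X | forall p, p \in s -> S p <-> R p].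
pose F := filter_from [set: seq (X * X)] agree.
have FF : Filter F.
  apply: filter_from_filter; first by exists [::].
  move=> s t _ _; exists (s ++ t) => // S st; split=> p ps; apply: st;
    by rewrite mem_cat ps ?orbT.
(* The filter generated by finite agreement with [R] converges to [R], so [U] contains one of its
   basic sets. *)
move=> nU; have [|s _ sU] := @cvg_fell F R FF _ U nU; last by exists s.
by move=> p; exists [:: p] => // S; apply; rewrite inE.
Qed.

Lemma near_fell_sub (B : set (fell X)) (R : set_type B) p :
  nbhs R [set S : set_type B | val S p <-> val R p].
Proof. exact: (@set_val_continuous _ B R _ (near_fell (val R) p)). Qed.

Lemma cvg_fell_sub (B : set (fell X)) (F : set_system (set_type B))
    (R : set_type B) : Filter F ->
  (forall p, F [set S : set_type B | val S p <-> val R p]) -> F --> R.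
Proof.
by move=> FF nF; apply: cvg_set_type; apply: cvg_fell => p; exact: nF.
Qed.

(** Reduces the continuity proofs below to one pair at a time. *)
Lemma continuous_fell_sub (T : topologicalType) (B : set (fell X))
    (f : T -> set_type B) :
  (forall t p, nbhs t [set s | val (f s) p <-> val (f t) p]) -> continuous f.
Proof. by move=> nf t; apply: cvg_fell_sub; exact: nf. Qed.

Lemma fell_hausdorff (B : set (fell X)) : hausdorff_space (set_type B).
Proof.
move=> R S RS; apply/val_inj/seteqP; split=> p Hp;
  have [T [/= TR TS]] := RS _ _ (near_fell_sub R p) (near_fell_sub S p);
  tauto.
Qed.

(** An ultrafilter decides every pair; its limit [L] collects the pairs that almost all relations
    contain. *)
Lemma fell_compact (B : set (fell X)) : closed B -> compact [set: set_type B].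
Proof.
move=> cB; rewrite compact_ultra => F UF _.
pose L : fell X := [set p | F [set R : set_type B | val R p]].
have FL p : F [set R : set_type B | val R p <-> L p].
  have [Fp|Fp] := in_ultra_setVsetC [set R : set_type B | val R p] UF.
    by apply: filterS (Fp) => R /= Rp; split.
  apply: filterS (Fp) => R /= nRp; split=> // Lp.
  by have [S []] := filter_ex (filterI Fp Lp).
have BL : B L.
  (* Agreement with [L] on finitely many pairs is a large set, hence realised by some member of
     [B]. *)
  apply: cB => U /fell_nbhs_finite [s sU].
  have : F (\bigcap_(p in [set` [fset p in s]%fset])
            [set R : set_type B | val R p <-> L p]).
    by apply: filter_bigI => p _; exact: FL.
  move=> /filter_ex [R RL]; exists (val R); split; first exact: set_valP.
  by apply: sU => p ps; apply: RL; rewrite /= inE.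
exists (exist _ L (mem_set BL)); split=> //.
exact: cvg_fell_sub.
Qed.

End FellTopology.

(** * Graphs of partial bijections and their inverse monoid structure *)

Section SymmetricInverseMonoid.
Variable X : choiceType.
Implicit Types (f : partial_bij X) (R S : fell X).

Lemma partial_bij_inj f x1 x2 y :
  val f x1 = Some y -> val f x2 = Some y -> x1 = x2.
Proof. by have /asboolP := valP f; exact. Qed.

(** Describes the graphs of partial bijections by conditions on two pairs at a time, the form that
    passes to closures. *)
Definition biunique R :=
  (forall x y1 y2, R (x, y1) -> R (x, y2) -> y1 = y2) /\
  (forall x1 x2 y, R (x1, y) -> R (x2, y) -> x1 = x2).

Lemma range_pgraphE : range (@pgraph X) = biunique.
Proof.
apply/seteqP; split=> [_ [f _ <-]|R [Rf Ri]].
  split=> [x y1 y2|x1 x2 y]; rewrite /pgraph /=; last exact: partial_bij_inj.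
  by move=> -> [].
pose h x :=
  if pselect (exists y, R (x, y)) is left e then Some (sval (cid e)) else None.
have hR x y : h x = Some y <-> R (x, y).
  rewrite /h; case: pselect => [e|ne].
    split=> [[<-]|Rxy]; first exact: svalP (cid e).
    by congr Some; exact: Rf (svalP (cid e)) Rxy.
  by split=> // Rxy; case: ne; exists y.
have hi : `[< forall x1 x2 y, h x1 = Some y -> h x2 = Some y -> x1 = x2 >].
  by apply/asboolP => x1 x2 y /hR ? /hR; exact: Ri.
exists (exist _ h hi : partial_bij X) => //.
by apply/seteqP; split=> -[x y]; rewrite /pgraph /= hR.
Qed.

Lemma pgraph_inj : injective (@pgraph X).
Proof.
move=> f g /seteqP [fg gf]; apply/val_inj/funext => x.
case fx: (val f x) => [y|].
  by have := fg (x, y) fx; rewrite /pgraph /= => ->.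
case gx: (val g x) => [y|//].
by have := gf (x, y) gx; rewrite /pgraph /= fx.
Qed.

Lemma pgraph1 : pgraph 1 = (1 : fell X).
Proof. by apply/seteqP; split=> -[x y] => [[]//|/= xy]; congr Some. Qed.

Lemma pgraphM f g : pgraph (f * g) = (pgraph f : fell X) * pgraph g.
Proof.
apply/seteqP; split=> -[x y]; rewrite /pgraph /= /pcomp.
  by case gx: (val g x) => [z|//] /= fz; exists z.
by move=> [z [/= -> /= ->]].
Qed.

Lemma biuniqueM R S : biunique R -> biunique S -> biunique (R * S).
Proof.
move=> [Rf Ri] [Sf Si]; split.
  move=> x y1 y2 [z [/= Sz Rz]] [w [/= Sw Rw]].
  by rewrite (Sf _ _ _ Sw Sz) in Rw; exact: Rf Rz Rw.
move=> x1 x2 y [z [/= Sz Rz]] [w [/= Sw Rw]].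
by rewrite (Ri _ _ _ Rw Rz) in Sw; exact: Si Sz Sw.
Qed.

Lemma biuniqueV R : biunique R -> biunique R^-1.
Proof.
by move=> [Rf Ri]; split=> [x y1 y2|x1 x2 y]; [exact: Ri|exact: Rf].
Qed.

Lemma biunique_mulVK R : biunique R -> R * R^-1 * R = R.
Proof.
move=> [Rf Ri]; apply/seteqP; split=> -[x y].
  move=> [z [/= Rxz [w [/= Rwz Rwy]]]].
  by rewrite (Ri _ _ _ Rxz Rwz).
by move=> Rxy; exists y; split=> //; exists x.
Qed.

Lemma biunique_inv_unique R S : biunique R -> biunique S ->
  R * S * R = R -> S * R * S = S -> S = R^-1.
Proof.
(* The hypotheses are symmetric in [R] and [S], so one inclusion, used twice, gives equality. *)
suff sub (P Q : fell X) : biunique P -> P * Q * P = P -> P `<=` (Q^-1 : fell X).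
  move=> Ru Su RSR SRS; apply/seteqP; split; first exact: sub.
  by move=> [x y]; exact: (sub _ _ Ru RSR (y, x)).
move=> [Pf Pi] PQP [x y] Pxy; have := Pxy; rewrite -[X in X (x, y)]PQP.
(* The path from [x] through [z] and [w] to [y] has [z = y] and [w = x] by biuniqueness of [P], so
   its middle edge is [Q (y, x)]. *)
move=> [z [/= Pxz [w [/= Qzw Pwy]]]].
by rewrite /= -(Pf _ _ _ Pxy Pxz) -(Pi _ _ _ Pxy Pwy) in Qzw.
Qed.

End SymmetricInverseMonoid.

(** The complement of [A] is infinite, so it contains a finite set [C] with at least [size s]
    elements; each [x] goes to the element of [C] at the position of [x] in [s]. *)
Lemma infinite_fresh (X : choiceType) (A : seq X) :
  infinite_set [set: X] -> forall s : seq X, exists e : X -> X,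
    {in s &, injective e} /\ {in s, forall x, e x \notin A}.
Proof.
move=> infX s.
have /infinite_set_fset - /(_ (size s)) [C CA sC] :=
  infinite_setD infX (finite_seq A).
(* The head [x0] is only the default of [nth]; on the list all indices are in range. *)
case: s sC => [|x0 s] sC; first by exists id.
set t := x0 :: s in sC *.
have lt x : x \in t -> index x t < size (enum_fset C).
  by rewrite -index_mem => /leq_trans; apply.
exists (fun x => nth x0 (enum_fset C) (index x t)).
split=> [x y xt yt /eqP|x xt].
  rewrite nth_uniq ?lt ?fset_uniq // => /eqP exy.
  by rewrite -(nth_index x0 xt) exy nth_index.
have /CA [_ /negP] : [set` C] (nth x0 (enum_fset C) (index x t)).
  by apply: mem_nth; exact: lt.
by [].
Qed.

(** * Identification of the closure of the group graphs *)

Section GraphClosureTheory.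
Variables (X : choiceType) (G : groupClosed (symgroup X)).
Implicit Types (g h : subgroup G) (R S : fell X).

Lemma graph_mapP g x y : graph_map g (x, y) <-> (val g : symgroup X) x = y.
Proof. by split=> [[_ _ [-> <-]]|<-]; last exists x. Qed.

Lemma biunique_graph_map g : biunique (graph_map g).
Proof.
split=> [x y1 y2 /graph_mapP <- /graph_mapP //|x1 x2 y].
move=> /graph_mapP <- /graph_mapP.
by move/(bij_inj (sym_bij _)).
Qed.

Lemma graph_map1 : graph_map (1 : subgroup G) = (1 : fell X).
Proof.
apply/seteqP; split=> -[x y]; first by move=> /graph_mapP.
by move=> xy; apply/graph_mapP.
Qed.

Lemma graph_mapM g h :
  graph_map (g * h) = (graph_map g : fell X) * graph_map h.
Proof.
apply/seteqP; split=> -[x y].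
  move=> /graph_mapP <-; exists ((val h : symgroup X) x).
  by split; exact/graph_mapP.
move=> [z [/= /graph_mapP <- /graph_mapP <-]]; exact/graph_mapP.
Qed.

Lemma graph_mapV g : graph_map g^-1 = (graph_map g : fell X)^-1.
Proof.
apply/seteqP; split=> -[x y].
  move=> /graph_mapP <-; apply/graph_mapP; exact: sym_mulKV.
by move=> /graph_mapP gyx; apply/graph_mapP; rewrite -[x]gyx; exact: sym_mulVK.
Qed.

Lemma graph_map_inj : injective (@graph_map X G).
Proof.
move=> g h gh; apply/val_inj/symP => x; apply/graph_mapP; rewrite gh.
exact/graph_mapP.
Qed.

Lemma ultratransitive_seq (s : seq X) (e : X -> X) : ultratransitive G ->
  {in s &, injective e} ->
  exists g, {in s, forall x, (val g : symgroup X) x = e x}.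
Proof.
(* Ultratransitivity needs an injective family of points, so repetitions are removed. *)
move=> uG einj; pose t := in_tuple (undup s).
have ts i : tnth t i \in s by rewrite -mem_undup; exact: mem_tnth.
have tinj : injective (tnth t) by apply/tuple_uniqP; exact: undup_uniq.
have [|g Gg gt] := uG _ (tnth t) (e \o tnth t) tinj.
  by move=> i j /einj - /(_ (ts i) (ts j)) /tinj.
exists (exist _ g Gg) => x; rewrite -mem_undup.
have -> : (x \in undup s) = (x \in t) by [].
by move=> /tnthP [i ->]; exact: gt.
Qed.

(** Any two pairs of [R] lie together in the graph of a single group element, which is biunique. *)
Lemma closure_biunique R : graph_closure G R -> biunique R.
Proof.
have near2 p q : graph_closure G R -> R p -> R q ->
    exists g, graph_map g p /\ graph_map g q.
  move=> clR Rp Rq.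
  have [_ [[g _ <-] [gp gq]]] :=
    clR _ (filterI (near_fell R p) (near_fell R q)).
  by exists g; split; [exact/gp|exact/gq].
move=> clR; split=> [x y1 y2|x1 x2 y] R1 R2;
  have [g [g1 g2]] := near2 _ _ clR R1 R2;
  have [gf gi] := biunique_graph_map g; [exact: gf g1 g2|exact: gi g1 g2].
Qed.

Lemma pgraph_closure (f : partial_bij X) :
  infinite_set [set: X] -> ultratransitive G -> graph_closure G (pgraph f).
Proof.
move=> infX uG U /fell_nbhs_finite [s sU].
pose a := [seq p.1 | p <- s].
(* Avoiding the second coordinates keeps the new pairs out of [s]; avoiding the values of [f] on [a]
   keeps the extension [k] injective. *)
have [e [einj eN]] :=
  infinite_fresh ([seq p.2 | p <- s] ++ pmap (val f) a) infX a.
pose k x := odflt (e x) (val f x).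
have fresh x x' y : x \in a -> x' \in a -> val f x = Some y -> e x' <> y.
  move=> xa x'a fx ex'; have := eN _ x'a; rewrite mem_cat negb_or => /andP [_].
  by rewrite ex' mem_pmap -fx map_f.
have kinj : {in a &, injective k}.
  move=> x x' xa x'a; rewrite /k.
  case fx: (val f x) => [y|]; case fx': (val f x') => [y'|] //= E.
  - by rewrite E in fx; exact: partial_bij_inj fx fx'.
  - by case: (fresh _ _ _ xa x'a fx).
  - by case: (fresh _ _ _ x'a xa fx').
  - exact: einj.
have [g gk] := ultratransitive_seq uG kinj.
exists (graph_map g); split; first by exists g.
apply: sU => -[x y] ps; have xa : x \in a by apply: map_f ps.
apply: (iff_trans (graph_mapP _ _ _)); rewrite gk // /k /pgraph /=.
(* Where [f] is undefined, [(x, y)] is not in its graph, and the fresh value [e x] differs from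
   [y]. *)
case fx: (val f x) => [z|] /=; first by split=> [->|[]].
split=> // ey; have := eN _ xa; rewrite mem_cat ey.
by rewrite (map_f snd ps).
Qed.

Lemma graph_closureE : infinite_set [set: X] -> ultratransitive G ->
  graph_closure G = biunique (X := X).
Proof.
move=> infX uG; apply/seteqP; split=> [R|]; first exact: closure_biunique.
by rewrite -range_pgraphE => _ [f _ <-]; exact: pgraph_closure.
Qed.

End GraphClosureTheory.

(** * The graph map as a compactification *)

Section GraphEmbedding.
Variables (X : choiceType) (G : groupClosed (symgroup X)).
Implicit Types (g h : subgroup G).

Lemma near_subgroup g x :
  nbhs g [set h | (val h : symgroup X) x = (val g : symgroup X) x].
Proof. exact: (subgroup_val_continuous (near_sym (val g : symgroup X) x)). Qed.

Lemma graph_emb_continuous : continuous (@graph_emb X G).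
Proof.
apply: continuous_fell_sub => g [x y].
apply: filterS (near_subgroup g x) => h /= hx.
by apply: (iff_trans (graph_mapP _ _ _)); rewrite hx -graph_mapP.
Qed.

(* For openness: the initial topology of the graph map refines that of
   [G], as the condition [h x = g x] says that the graph of [h] contains [(x, g x)]. *)
Lemma graph_emb_embedding : topological_embedding (@graph_emb X G).
Proof.
split; first by move=> g h [] /graph_map_inj.
  exact: graph_emb_continuous.
pose W := initial_topology (@graph_emb X G).
have cW : continuous (id : W -> subgroup G).
  apply: (@subgroup_continuous (symgroup X) G W id).
  apply: (@sym_continuous X W) => g x.
  pose p := (x, (val (g : subgroup G) : symgroup X) x).
  have nW : nbhs g [set h : W | graph_map (h : subgroup G) p <->
                               graph_map (g : subgroup G) p].
    exact: (@initial_continuous _ _ (@graph_emb X G) g _ (near_fell_sub _ p)).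
  by apply: filterS nW => h /= [_ gh]; apply/graph_mapP/gh/graph_mapP.
move: cW => /continuousP cW U /cW [V oV VU].
exists V => //; rewrite -[U]VU; apply/seteqP; split.
  by move=> _ [g Vg <-]; split=> //; exists g.
by move=> R [VR [g _ gE]]; exists g => //=; rewrite /preimage /= gE.
Qed.

Lemma graph_emb_dense : dense (range (@graph_emb X G)).
Proof.
move=> O [R OR] [U oU UO]; have UR : U (val R) by move: OR; rewrite -UO.
have [|_ [[g _ <-] Ug]] := set_valP R U; first exact: open_nbhs_nbhs.
by exists (graph_emb g); split; [rewrite -UO|exists g].
Qed.

Lemma graph_emb_compactification : compactification (@graph_emb X G).
Proof.
split; [exact/fell_compact/closed_closure|exact: fell_hausdorff| |].
  exact: graph_emb_embedding.
exact: graph_emb_dense.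
Qed.

End GraphEmbedding.

(** * Inverse monoid operations on the closure and their continuity *)

Section ClosureMonoid.
Variables (X : choiceType) (G : groupClosed (symgroup X)).
(** This equality makes the closure stable under composition and inversion of relations. *)
Hypothesis closureE : graph_closure G = biunique (X := X).
Local Notation B := (set_type (graph_closure G)).
Implicit Types (g h : subgroup G) (R S : B).

Lemma biunique_closure R : biunique (val R).
Proof. by rewrite -closureE; exact: set_valP. Qed.

Lemma mem_closure_biunique (P : fell X) : biunique P -> P \in graph_closure G.
Proof. by move=> uP; rewrite inE closureE. Qed.

Lemma closure_mul_subproof R S :
  (val R : fell X) * val S \in graph_closure G.
Proof.
by apply/mem_closure_biunique/biuniqueM; exact: biunique_closure.
Qed.

Lemma closure_inv_subproof R : (val R : fell X)^-1 \in graph_closure G.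
Proof. by apply/mem_closure_biunique/biuniqueV/biunique_closure. Qed.

Definition closure_mul R S : B := SigSub (closure_mul_subproof R S).
Definition closure_inv R : B := SigSub (closure_inv_subproof R).

Lemma closure_mul1 : left_id (graph_emb 1) closure_mul.
Proof. by move=> R; apply: val_inj; rewrite /= graph_map1 mul1g. Qed.

Lemma closure_mulr1 : right_id (graph_emb 1) closure_mul.
Proof. by move=> R; apply: val_inj; rewrite /= graph_map1 mulg1. Qed.

Lemma closure_mulA : associative closure_mul.
Proof. by move=> R S T; apply: val_inj; rewrite /= mulgA. Qed.

Lemma graph_embM : {morph @graph_emb X G : g h / g * h >-> closure_mul g h}.
Proof. by move=> g h; apply: val_inj; exact: graph_mapM. Qed.

Lemma graph_embV : {morph @graph_emb X G : g / g^-1 >-> closure_inv g}.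
Proof. by move=> g; apply: val_inj; exact: graph_mapV. Qed.

(* [(x, y)] lies in [R * S] iff [(z, y)] lies in [R] for the unique [z] with
   [(x, z)] in [S], so one coordinate of [R] decides it. *)
Lemma closure_mul_continuousl S : continuous (closure_mul^~ S).
Proof.
apply: continuous_fell_sub => R [x y]; have [Sf _] := biunique_closure S.
have [[z Sxz]|nS] := pselect (exists z, val S (x, z)).
  apply: filterS (near_fell_sub R (z, y)) => T /= TR.
  by split=> -[w [/= Sxw]]; rewrite -(Sf _ _ _ Sxz Sxw) => /TR; exists z.
apply: filterS (near_fell_sub R (x, y)) => T _.
by split=> -[z [/= Sxz _]]; case: nS; exists z.
Qed.

Lemma closure_inv_continuous : continuous closure_inv.
Proof.
apply: continuous_fell_sub => R [x y]; exact: (near_fell_sub R (y, x)).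
Qed.

Lemma closure_invK : involutive closure_inv.
Proof. by move=> R; apply: val_inj; exact: rel_invK. Qed.

Lemma closure_invM :
  {morph closure_inv : R S / closure_mul R S >-> closure_mul S R}.
Proof. by move=> R S; apply: val_inj; exact: rel_invM. Qed.

(** Inversion is a continuous anti-automorphism, so it turns multiplication on one side into
    multiplication on the other. *)
Lemma closure_mul_continuousr R : continuous (closure_mul R).
Proof.
have -> : closure_mul R =
    closure_inv \o (closure_mul^~ (closure_inv R) \o closure_inv).
  by apply/funext => S; rewrite /= closure_invM !closure_invK.
move=> S; apply: continuous_comp; last exact: closure_inv_continuous.
apply: continuous_comp; last exact: closure_mul_continuousl.
exact: closure_inv_continuous.
Qed.

(** Joint continuity does not follow from separate continuity. Here a pair [(x, y)] lies in the
    product of the graph of [h] with [S] iff [(x, z)] lies in [S], where [z] is the preimage of [y]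
    under [h], and [z] is locally constant in [h]. *)
Lemma closure_act_continuous :
  continuous (fun p : subgroup G * B => closure_mul (graph_emb p.1) p.2).
Proof.
apply: continuous_fell_sub => -[g R] [x y].
pose z := (val g^-1 : symgroup X) y.
have inE h : (val h^-1 : symgroup X) y = z ->
    forall S, val (closure_mul (graph_emb h) S) (x, y) <-> val S (x, z).
  move=> hz S; split=> [[w [/= Sxw /graph_mapP hw]]|Sxz].
    by rewrite -hz -hw [X in val S (x, X)]sym_mulVK.
  by exists z; split=> //; apply/graph_mapP; rewrite -hz; exact: sym_mulKV.
exists ([set h | (val h^-1 : symgroup X) y = z],
        [set S : B | val S (x, z) <-> val R (x, z)]).
  split; last exact: near_fell_sub.
  (* Continuity of inversion in the group keeps the preimage of [y] fixed near [g]. *)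
  exact: (@invg_continuous (subgroup G) g _ (near_subgroup g^-1 y)).
move=> [h S] [/= hz SR].
apply: (iff_trans (inE _ hz S)); apply: (iff_trans SR).
exact: iff_sym (inE g erefl R).
Qed.

Lemma closure_inverseP R S :
  closure_mul (closure_mul R S) R = R /\ closure_mul (closure_mul S R) S = S <->
  S = closure_inv R.
Proof.
split=> [[/(congr1 val) /= RSR /(congr1 val) /= SRS]|->].
  apply: val_inj; apply: biunique_inv_unique => //; exact: biunique_closure.
split; apply: val_inj; apply: biunique_mulVK; first exact: biunique_closure.
by apply: biuniqueV; exact: biunique_closure.
Qed.

Lemma closure_sim_compactification :
  sim_compactification (@graph_emb X G) closure_mul closure_inv.
Proof.
split; [split| |exact: closure_inv_continuous|exact: graph_embV].
- split; first exact: graph_emb_compactification.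
  exists (fun g => closure_mul (graph_emb g)); split.
  + exact: closure_mul1.
  + by move=> g h R; rewrite graph_embM closure_mulA.
  + exact: closure_act_continuous.
  + by move=> g h; rewrite graph_embM.
- split; first exact: closure_mulA.
  by split; [exact: closure_mul1|exact: closure_mulr1].
- exact: graph_embM.
- move=> R; split; first exact: closure_mul_continuousr.
  exact: closure_mul_continuousl.
- exact: closure_inverseP.
Qed.

Lemma pgraph_closure_subproof (f : partial_bij X) :
  pgraph f \in graph_closure G.
Proof. by apply: mem_closure_biunique; rewrite -range_pgraphE; exists f. Qed.

Definition closure_pgraph (f : partial_bij X) : B :=
  SigSub (pgraph_closure_subproof f).

Lemma closure_pgraph_bij : bijective closure_pgraph.
Proof.
rewrite -setTT_bijective; split=> //.
  by move=> f g _ _ [] /pgraph_inj.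
move=> R _; have : range (@pgraph X) (val R).
  by rewrite range_pgraphE; exact: biunique_closure.
by move=> [f _ fR]; exists f => //; exact: val_inj.
Qed.

End ClosureMonoid.

Unset Implicit Arguments.

Theorem proposition4p7 (X : choiceType) (G : groupClosed (symgroup X)) :
  infinite_set [set: X] -> ultratransitive G ->
  graph_closure G = range (@pgraph X) /\
  exists (mul : set_type (graph_closure G) -> set_type (graph_closure G) ->
                set_type (graph_closure G))
         (inv : set_type (graph_closure G) -> set_type (graph_closure G)),
    [/\ forall R S, val (mul R S) = val R * val S,
        forall R, val (inv R) = (val R)^-1,
        exists phi : partial_bij X -> set_type (graph_closure G),
          [/\ bijective phi,
              forall f, val (phi f) = pgraph f,
              phi 1 = graph_emb 1 &
              {morph phi : f g / f * g >-> mul f g}] &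
        sim_compactification (@graph_emb X G) mul inv].
Proof.
move=> infX uG; have clE := graph_closureE infX uG.
split; first by rewrite clE range_pgraphE.
exists (closure_mul clE), (closure_inv clE); split=> //; last first.
  exact: closure_sim_compactification.
exists (closure_pgraph clE); split=> //; first exact: closure_pgraph_bij.
  by apply: val_inj; rewrite /= graph_map1 pgraph1.
by move=> f g; apply: val_inj; exact: pgraphM.
Qed.
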